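(* Let $p$ be an odd prime. There is a unique walk of maximal length on $\mathcal{G}_p$, there is a unique walk of maximal length among the $(p-1)$-recurrent walks on $\mathcal{G}_p$, and these two walks coincide.
   Context: The additive residue graph $\mathcal{G}_p$ is the directed labelled graph with vertex set $\mathbb{Z}/p\mathbb{Z}$ and, for each vertex $r$ and each $1\le i\le p-1$, an edge labelled $i$ (an $i$-edge) from $r$ to $r+i$. A walk on $\mathcal{G}_p$ means a finite walk starting at vertex $0$ whose edge labels are weakly increasing along the walk and which never returns to vertex $0$; its length is its number of edges. A walk is $(p-1)$-recurrent if for every $1\le i\le p-1$ it contains an $i$-edge incident to the vertex $p-1$ (i.e. starting or ending at $p-1$). *)

(* Defs.v *)
From mathcomp Require Import all_boot all_algebra.
Set Implicit Arguments.
Unset Strict Implicit.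
Unset Printing Implicit Defensive.
Import GRing.Theory.
Local Open Scope ring_scope.

(* The pair (r, i) stands for the i-edge r -> r + i; since each vertex has
   exactly one outgoing i-edge, source and label determine the edge.
   'Z_p is Z/pZ only for 1 < p. *)
Definition edge (p : nat) : Type := ('Z_p * nat)%type.

Definition source (p : nat) (e : edge p) : 'Z_p := e.1.
Definition label (p : nat) (e : edge p) : nat := e.2.
Definition target (p : nat) (e : edge p) : 'Z_p := source e + (label e)%:R.

Definition in_graph (p : nat) (e : edge p) : bool :=
  (1 <= label e <= p.-1)%N.

Fixpoint consecutive (p : nat) (r : 'Z_p) (w : seq (edge p)) : bool :=
  if w is e :: w' then (source e == r) && consecutive (target e) w' else true.

Definition walk (p : nat) (w : seq (edge p)) : Prop :=
  [/\ all (@in_graph p) w,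
      consecutive 0 w,
      sorted leq (map (@label p) w)
    & all (fun e => target e != 0) w].

Definition incident (p : nat) (e : edge p) (v : 'Z_p) : bool :=
  (source e == v) || (target e == v).

Definition recurrent (p : nat) (v : 'Z_p) (w : seq (edge p)) : Prop :=
  forall i : nat, (1 <= i <= p.-1)%N ->
    exists e : edge p, [/\ e \in (w : seq ('Z_p * nat)), label e = i & incident e v].

Definition longest (p : nat) (P : seq (edge p) -> Prop) (w : seq (edge p)) :
    Prop :=
  P w /\ forall w' : seq (edge p), P w' -> (size w' <= size w)%N.

(* Main.v *)
(** Let [pos i v] be the number of [i]-edges leading from [0] to [v], i.e. [v / i]
    in [{0, ..., p-1}].  An [i]-edge of a walk raises [pos i] by exactly one, so
    a walk that passes from label [i] to [i+1] at the vertex [S_i] has length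
    [sum_i (pos i S_i - pos (i+1) S_i)], the last term being [pos (p-1) S_(p-1)].
    The difference [pos i v - pos (i+1) v] is congruent to [v / (i (i+1))], hence
    injective in [v], and the maximal walk can only switch at its maximizers
    [V_i].  Comparing [V_i] with [V_i + i + 1] and [V_i - i] gives
    [pos i V_(i-1) <= pos i (-1) <= pos i V_i], not both equalities: the
    switches at the [V_i] do form a walk, and its [i]-edges touch [-1]. *)
Require Import Defs.
From mathcomp Require Import all_boot all_algebra.
From mathcomp Require Import zify ring.
Set Implicit Arguments.
Unset Strict Implicit.
Import GRing.Theory.

Section PrimeModulus.

Variables (p : nat) (p_prime : prime p) (p_odd : odd p).

Let p_gt1 : 1 < p := prime_gt1 p_prime.
Let p_gt2 : 2 < p := odd_prime_gt2 p_odd p_prime.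

(** * Positions of the vertices along the [i]-edges *)

Lemma unit_label (i : nat) : 0 < i < p -> (i%:R : 'Z_p)%R \is a GRing.unit.
Proof.
move=> /andP[i_gt0 i_ltp]; rewrite unitZpE // prime_coprime //.
by apply/negP => /(dvdn_leq i_gt0); lia.
Qed.

Definition pos (i : nat) (v : 'Z_p) : nat := (v / i%:R : 'Z_p)%R.

Lemma pos_lt (i : nat) (v : 'Z_p) : pos i v < p.
Proof. by rewrite -[X in _ < X](Zp_cast p_gt1) /pos ltn_ord. Qed.

Lemma pos0 (i : nat) : pos i 0%R = 0.
Proof. by rewrite /pos mul0r. Qed.

Lemma pos_inj (i : nat) : 0 < i < p -> injective (pos i).
Proof.
by move=> /unit_label ui v w /ord_inj /(mulIr _); apply; rewrite unitrV.
Qed.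

Lemma pos_gt0 (i : nat) (v : 'Z_p) : 0 < i < p -> v != 0%R -> 0 < pos i v.
Proof.
move=> i_lt; apply: contraR; rewrite -eqn0Ngt -(pos0 i) => /eqP pos_v0.
exact/eqP/(pos_inj i_lt).
Qed.

(* Thanks to the junk value [v / 0 = 0], the last label [p.-1] is not a special
   case in the telescoping sum. *)
Lemma pos_p (v : 'Z_p) : pos p v = 0.
Proof.
by rewrite /pos pchar_Zp // invr0 mulr0.
Qed.

Lemma posD (i : nat) (v w : 'Z_p) :
  pos i (v + w)%R =
  pos i v + pos i w - (if pos i v + pos i w < p then 0 else p).
Proof.
have -> : pos i (v + w)%R = (pos i v + pos i w) %% p.
  by rewrite /pos mulrDl; apply: congr1 (Zp_cast p_gt1).
have [ltp|lep] := ltnP; first by rewrite modn_small ?subn0.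
rewrite -{1}(subnK lep) modnDr modn_small //.
by have := pos_lt i v; have := pos_lt i w; lia.
Qed.

Lemma pos_label (i : nat) : 0 < i < p -> pos i i%:R%R = 1.
Proof. by move=> /unit_label ui; rewrite /pos divrr //= modn_small. Qed.

Lemma pos1_gt0 (i : nat) : 0 < i < p -> 0 < pos i 1%R.
Proof. by move=> i_lt; apply: pos_gt0 (oner_neq0 _). Qed.

Lemma posN (i : nat) (v : 'Z_p) : 0 < pos i v -> pos i (- v)%R = p - pos i v.
Proof.
have := posD i (- v)%R v; rewrite addNr pos0.
have := pos_lt i v; have := pos_lt i (- v)%R; case: ifP; lia.
Qed.

Lemma posN1 (i : nat) : 0 < i < p -> pos i (- 1)%R = p - pos i 1%R.
Proof. by move=> i_lt; rewrite posN ?pos1_gt0. Qed.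

Lemma pos_succ (i : nat) : 0 < i -> i.+1 < p ->
  pos i i.+1%:R%R = (pos i 1%R).+1.
Proof.
move=> i_gt0 iltp; have i_lt : 0 < i < p by lia.
have /(pos_gt0 i_lt) : (i.+1%:R : 'Z_p)%R != 0%R.
  have /unit_label : 0 < i.+1 < p by lia.
  by apply: contraTneq => ->; rewrite unitr0.
rewrite -natr1 posD pos_label //; have := pos_lt i 1%R; case: ifP; lia.
Qed.

(** * Gain of a label change and its unique maximizer *)

(* Shifted by [p] to stay in [nat]. *)
Definition gain (i : nat) (v : 'Z_p) : nat := pos i v + p - pos i.+1 v.

Definition switch (i : nat) : 'Z_p := [arg max_(v > 0%R) gain i v].

Definition max_gain (i : nat) : nat := pos i (switch i) - pos i.+1 (switch i).

Lemma gain_inj (i : nat) : 0 < i < p -> injective (gain i).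
Proof.
move=> i_lt v w; rewrite /gain => eq_vw.
have [ltv ltw] := (pos_lt i.+1 v, pos_lt i.+1 w).
have [ip|iltp] : i.+1 = p \/ i.+1 < p by lia.
  by move: eq_vw; rewrite ip !pos_p => ?; apply: (pos_inj i_lt); lia.
have{eq_vw ltv ltw} /(congr1 (fun n => n%:R : 'Z_p)%R) :
  pos i v + pos i.+1 w = pos i w + pos i.+1 v by lia.
rewrite !natrD /pos !natr_Zp => eq_vw.
have ui := unit_label i_lt; have ui1 : (i.+1%:R : 'Z_p)%R \is a GRing.unit.
  by apply: unit_label; lia.
(* As [1/i - 1/(i+1)] is invertible, it can be cancelled from [eq_vw]. *)
have det1 : ((i%:R^-1 - i.+1%:R^-1) * (i%:R * i.+1%:R) = 1 :> 'Z_p)%R.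
  by rewrite mulrBl mulKr // mulrCA mulVr // mulr1 -natr1 addrC addKr.
rewrite -[v]mulr1 -[w]mulr1 -det1 !mulrA; congr (_ * _ * _)%R.
by rewrite !mulrBr; apply/eqP; rewrite subr_eq addrAC -eq_vw addrK.
Qed.

Lemma leq_gain_switch (i : nat) (v : 'Z_p) : gain i v <= gain i (switch i).
Proof. by rewrite /switch; case: arg_maxnP => // w _; apply. Qed.

(** The vertex [0] already has gain [p]. This makes the truncated subtraction in [max_gain]
    exact. *)
Lemma pos_switch_leq (i : nat) : pos i.+1 (switch i) <= pos i (switch i).
Proof.
have := leq_gain_switch i 0%R; have := pos_lt i.+1 (switch i).
by rewrite /gain !pos0; lia.
Qed.

Lemma leq_max_gain (i : nat) (v : 'Z_p) : pos i v <= pos i.+1 v + max_gain i.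
Proof.
have := leq_gain_switch i v; have := pos_switch_leq i.
have := pos_lt i.+1 (switch i); have := pos_lt i.+1 v.
by rewrite /gain /max_gain; lia.
Qed.

Lemma eq_max_gain (i : nat) (v : 'Z_p) : 0 < i < p ->
  pos i v = pos i.+1 v + max_gain i -> v = switch i.
Proof.
move=> i_lt eqv; apply: (gain_inj i_lt); have := pos_switch_leq i.
have := pos_lt i.+1 (switch i); have := pos_lt i.+1 v.
by move: eqv; rewrite /gain /max_gain; lia.
Qed.

Lemma pos_switch_last : pos p.-1 (switch p.-1) = p.-1.
Proof.
have lt1 : 0 < p.-1 < p by lia.
have := leq_gain_switch p.-1 (- p.-1%:R)%R; have := pos_lt p.-1 (switch p.-1).
have := posD p.-1 (- p.-1%:R)%R p.-1%:R%R; rewrite addNr pos0 pos_label //.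
have := pos_lt p.-1 (- p.-1%:R)%R; case: ifP => ?;
  rewrite /gain prednK ?pos_p; lia.
Qed.

(** * Order of the switches relative to [-1] *)

(* Otherwise [switch i + i.+1] would have a larger gain. *)
Lemma posN1_leq_switch (i : nat) : 0 < i < p ->
  pos i (- 1)%R <= pos i (switch i).
Proof.
move=> i_lt; have [ip|iltp] : i.+1 = p \/ i.+1 < p by lia.
  have -> : i = p.-1 by lia.
  by rewrite pos_switch_last; have := pos_lt p.-1 (- 1)%R; lia.
rewrite leqNgt posN1 //; apply/negP => lt_pos.
have [i_gt0 i1_lt] : 0 < i /\ 0 < i.+1 < p by lia.
have := leq_gain_switch i (switch i + i.+1%:R)%R; have := pos_switch_leq i.
have u_gt0 := pos1_gt0 i_lt.
(* A zero sum would put [switch i] at position [p - 1] for [i.+1], hence also for [i], against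
   [lt_pos]. So [pos i] rises by [pos i 1 + 1 >= 2] without wrapping, while [pos i.+1] rises by at
   most 1. *)
have v'_gt0 : 0 < pos i (switch i + i.+1%:R)%R.
  apply: pos_gt0 => //; apply/eqP => v'0.
  have := pos0 i.+1; rewrite -v'0 posD pos_label //.
  have := pos_switch_leq i; case: ifP; lia.
move: v'_gt0; rewrite /gain !posD pos_label // pos_succ //.
by do 2 (case: ifP => ?); lia.
Qed.

(* Otherwise [switch i - i] would have a larger gain. *)
Lemma pos_switch_leqN1 (i : nat) : 0 < i -> i.+1 < p ->
  pos i.+1 (switch i) <= pos i.+1 (- 1)%R.
Proof.
move=> i_gt0 iltp; have i_lt : 0 < i < p by lia.
have i1_lt : 0 < i.+1 < p by lia.
rewrite leqNgt posN1 //; apply/negP => lt_pos.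
(* Here [pos i] drops by 1. As [w + i.+1 = switch i + 1], where the right-hand sum wraps around,
   [pos i.+1] drops by [p + 1 - pos i.+1 1 >= 2]. *)
set w := (switch i - i%:R)%R; have := leq_gain_switch i w.
have := posD i w i%:R%R; rewrite /w subrK -/w pos_label //.
have := posD i.+1 (switch i) 1%R; have := posD i.+1 w i.+1%:R%R.
rewrite /w -natr1 addrA subrK -/w natr1 pos_label // => ->.
have := pos_switch_leq i; have := pos_lt i.+1 1%R.
have := pos_lt i.+1 (switch i); have := pos_lt i.+1 w; have := pos_lt i w.
by rewrite /gain; do 3 (case: ifP => ?); lia.
Qed.

(* In case of equality, [switch i] and [switch i.+1] are both [- 1]; compare
   the gains of [- 1] with those of [- i] and [i.+2] respectively. *)
Lemma pos_switch_lt (i : nat) : 0 < i -> i.+1 < p ->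
  pos i.+1 (switch i) < pos i.+1 (switch i.+1).
Proof.
move=> i_gt0 iltp; have i_lt : 0 < i < p by lia.
have i1_lt : 0 < i.+1 < p by lia.
have leN1 := pos_switch_leqN1 i_gt0 iltp.
have geN1 := posN1_leq_switch i1_lt.
have [ip|i2ltp] : i.+2 = p \/ i.+2 < p by lia.
  have ip1 : i.+1 = p.-1 by lia.
  suff : pos i.+1 (- 1)%R = 1 by move: leN1 geN1; rewrite ip1 pos_switch_last; lia.
  rewrite -(pos_label i1_lt); congr pos; apply/eqP; rewrite eq_sym -addr_eq0.
  by rewrite natr1 ip pchar_Zp.
have i2_lt : 0 < i.+2 < p by lia.
rewrite ltnNge; apply/negP => ge_pos.
have switch1 : switch i = (- 1)%R by apply: (pos_inj i1_lt); lia.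
have switch2 : switch i.+1 = (- 1)%R by apply: (pos_inj i1_lt); lia.
(* Let [a], [b], [c] be the positions of [1] for [i], [i.+1], [i.+2]. The two comparisons give
   [p + a <= 2b] and [2b <= c], against [c < p]. *)
have := leq_gain_switch i (- i%:R)%R; have := leq_gain_switch i.+1 i.+2%:R%R.
have posNi : pos i.+1 (- i%:R)%R = (pos i.+1 1%R).-1.
  have := posD i.+1 (- i.+1%:R)%R 1%R; rewrite posN pos_label //.
  have -> : (- i.+1%:R + 1)%R = (- i%:R)%R :> 'Z_p by rewrite -natr1; ring.
  by have := pos1_gt0 i1_lt; have := pos_lt i.+1 1%R; case: ifP; lia.
rewrite /gain switch1 switch2 posNi !posN1 // pos_succ // posN !pos_label //.
have := (pos1_gt0 i_lt, pos1_gt0 i1_lt, pos1_gt0 i2_lt).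
have := (pos_lt i 1%R, pos_lt i.+1 1%R, pos_lt i.+2 1%R).
by move=> [[? ?] ?] [[? ?] ?]; lia.
Qed.

(** Along [i]-edges the position can wrap around only by landing on [0]. *)
Lemma pos_step (i : nat) (v : 'Z_p) : 0 < i < p -> (v + i%:R)%R != 0%R ->
  pos i (v + i%:R)%R = (pos i v).+1.
Proof.
move=> i_lt /(pos_gt0 i_lt); have := pos_lt i v.
by rewrite posD pos_label //; case: ifP; lia.
Qed.

(** * Suffixes of walks, with any start vertex and label bound *)

Definition walk_from (j : nat) (r : 'Z_p) (w : seq (edge p)) : bool :=
  [&& all (@in_graph p) w, consecutive r w, path leq j (map (@label p) w)
    & all (fun e => target e != 0%R) w].

Lemma walkP (w : seq (edge p)) : walk w <-> walk_from 1 0%R w.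
Proof.
split=> [[w_in cw sw w0]|/and4P[w_in cw sw w0]].
  apply/and4P; split=> //; case: w w_in {cw w0} sw => //= e w.
  by rewrite {1}/in_graph -andbA => /and3P[-> _ _].
by split=> //; apply: path_sorted sw.
Qed.

Lemma walk_from_cons (j : nat) (r : 'Z_p) (e : edge p) (w : seq (edge p)) :
  walk_from j r (e :: w) =
  [&& in_graph e, source e == r, j <= label e, target e != 0%R
    & walk_from (label e) (target e) w].
Proof.
rewrite /walk_from /=; case: (in_graph e); case: (source e == r);
  case: (j <= label e); case: (target e == 0%R); rewrite /= ?andbF //.
Qed.

Lemma walk_from_leq (j k : nat) (r : 'Z_p) (w : seq (edge p)) :
  j <= k -> walk_from k r w -> walk_from j r w.
Proof.
case: w => [//|e w] le_jk; rewrite !walk_from_cons.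
by case/and5P=> -> -> /(leq_trans le_jk)-> -> ->.
Qed.

Variant walk_from_spec (j : nat) (r : 'Z_p) : seq (edge p) -> Prop :=
| WalkNext w of walk_from j.+1 r w : walk_from_spec j r w
| WalkStep w of (r + j%:R)%R != 0%R & walk_from j (r + j%:R)%R w :
    walk_from_spec j r ((r, j) :: w).

Lemma walk_fromP (j : nat) (r : 'Z_p) (w : seq (edge p)) :
  walk_from j r w -> walk_from_spec j r w.
Proof.
case: w => [|[s i] w]; first by move=> _; apply: WalkNext.
rewrite walk_from_cons /source /target /label /=.
case/and5P=> e_in /eqP eq_sr; rewrite eq_sr in e_in *.
rewrite leq_eqVlt => /predU1P[<-|lt_ji] t0 wi; first exact: WalkStep.
by apply: WalkNext; rewrite walk_from_cons; apply/and5P; split.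
Qed.

Lemma walk_from_p (r : 'Z_p) (w : seq (edge p)) : walk_from p r w -> w = [::].
Proof.
case: w => // e w; rewrite walk_from_cons /in_graph.
by case/and5P=> e_in _ ? _ _; lia.
Qed.

Lemma walk_from_ind (P : nat -> 'Z_p -> seq (edge p) -> Prop) :
  (forall r, P p r [::]) ->
  (forall j r w, 0 < j < p -> walk_from j.+1 r w -> P j.+1 r w -> P j r w) ->
  (forall j r w, 0 < j < p -> (r + j%:R)%R != 0%R ->
     walk_from j (r + j%:R)%R w -> P j (r + j%:R)%R w -> P j r ((r, j) :: w)) ->
  forall j r w, 0 < j <= p -> walk_from j r w -> P j r w.
Proof.
(* Raising the label bound lowers [p - j]; taking an edge lowers the size. *)
move=> Pp Pnext Pstep j r w; have [n le_n] := ubnP (size w + (p - j)).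
elim: n => // n IHn in j r w le_n *; move=> /andP[j_gt0].
rewrite leq_eqVlt => /predU1P[->|j_ltp] wj.
  by rewrite (walk_from_p wj).
have j_lt : 0 < j < p by rewrite j_gt0.
case: (walk_fromP wj) le_n => [w1 wj1|w1 t0 wj1] /= le_n.
  by apply: Pnext => //; apply: IHn => //; lia.
by apply: Pstep => //; apply: IHn => //; lia.
Qed.

(** * Upper bound on the length, and uniqueness *)

Definition max_from (j : nat) : nat := \sum_(j <= i < p) max_gain i.

Lemma max_fromS (j : nat) : j < p -> max_from j = max_gain j + max_from j.+1.
Proof. exact: big_ltn. Qed.

(** A [j]-edge trades one unit of length for one of position; leaving label [j] costs at most
    [max_gain j]. *)
Lemma size_walk_from (j : nat) (r : 'Z_p) (w : seq (edge p)) :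
  0 < j <= p -> walk_from j r w -> size w + pos j r <= max_from j.
Proof.
move: j r w; apply: walk_from_ind => [r|j r w j_lt _|j r w j_lt t0 _] /=.
- by rewrite pos_p.
- by rewrite (@max_fromS j); have := leq_max_gain j r; lia.
- by rewrite pos_step //; lia.
Qed.

Lemma maximal_next (j : nat) (r : 'Z_p) (w : seq (edge p)) :
  0 < j < p -> walk_from j.+1 r w -> size w + pos j r = max_from j ->
  r = switch j /\ size w + pos j.+1 r = max_from j.+1.
Proof.
move=> j_lt /size_walk_from; rewrite (@max_fromS j); last by lia.
move=> /(_ ltac:(lia)) le_size eq_size; have := leq_max_gain j r.
by split; [apply: eq_max_gain|]; lia.
Qed.

(** The position only rises under label [j], and equality in the bound forces leaving at
    [switch j]. *)
Lemma maximal_before_switch (j : nat) (r : 'Z_p) (w : seq (edge p)) :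
  0 < j <= p -> walk_from j r w -> size w + pos j r = max_from j ->
  pos j r <= pos j (switch j).
Proof.
move: j r w; apply: walk_from_ind => [r|j r w j_lt wj _|j r w j_lt t0 _] /=.
- by rewrite pos_p.
- by move=> /(maximal_next j_lt wj)[-> _].
- by rewrite pos_step //; lia.
Qed.

Lemma maximal_not_step (j : nat) (w : seq (edge p)) :
  0 < j < p -> (switch j + j%:R)%R != 0%R ->
  walk_from j (switch j + j%:R)%R w ->
  (size w).+1 + pos j (switch j) <> max_from j.
Proof.
move=> j_lt t0 wj eq_size; have := maximal_before_switch _ wj.
by rewrite pos_step //; lia.
Qed.

(** If one walk leaves label [j] and the other stays, the first is at [switch j] and the second
    overshoots it for good. *)
Lemma maximal_walk_inj (j : nat) (r : 'Z_p) (w w' : seq (edge p)) :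
  0 < j <= p -> walk_from j r w -> walk_from j r w' ->
  size w + pos j r = max_from j -> size w' + pos j r = max_from j -> w = w'.
Proof.
move=> j_lt wj; move: j r w j_lt wj w'.
apply: walk_from_ind => [r|j r w j_lt wj IHw|j r w j_lt t0 wj IHw] w' wj' /=.
- by rewrite (walk_from_p wj').
- move=> eqw; have [r_sw eqw1] := maximal_next j_lt wj eqw.
  case: (walk_fromP wj') => [w1 wj1|w1 t0 wj1] /=.
    by move=> /(maximal_next j_lt wj1)[_]; apply: IHw.
  by rewrite r_sw in t0 wj1 * => /maximal_not_step[].
- case: (walk_fromP wj') => [w1 wj1|w1 t1 wj1] /= eqw.
    case/(maximal_next j_lt wj1)=> r_sw _.
    by rewrite r_sw in t0 wj eqw; case/maximal_not_step: eqw.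
  by move=> eqw1; congr (_ :: _); apply: IHw => //; rewrite pos_step //; lia.
Qed.

(** * Construction of the maximal recurrent walk *)

Lemma exists_maximal_recurrent_walk (j : nat) (r : 'Z_p) :
  0 < j <= p -> (j < p -> pos j r <= pos j (switch j)) ->
  exists w : seq (edge p),
    [/\ walk_from j r w, size w + pos j r = max_from j
      & forall i, j <= i < p ->
          (i = j -> pos j r < pos j (switch j) /\ pos j r <= pos j (- 1)%R) ->
          exists e : edge p,
            [/\ e \in (w : seq ('Z_p * nat)), label e = i
              & incident e (- 1)%R]].
Proof.
(* Outer induction on the labels left, inner one on the distance to [switch j]. For the current
   label, recurrence is claimed only while a [j]-edge remains and [-1] has not been passed. *)
have [k] := ubnP (p - j); elim: k => // k IHj in j r *.
move=> le_k /andP[j_gt0]; rewrite leq_eqVlt => /predU1P[jp _|j_ltp /(_ j_ltp)].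
  exists [::]; split=> // [|i]; last by lia.
  by rewrite jp pos_p /max_from big_geq.
have j_lt : 0 < j < p by lia.
have [d] := ubnP (pos j (switch j) - pos j r); elim: d => // d IHr in r *.
move=> le_d; rewrite leq_eqVlt => /predU1P[/(pos_inj j_lt)->|r_lt].
  have lt_k : p - j.+1 < k by lia.
  have [||w [wj eqw recw]] := IHj j.+1 (switch j) lt_k; first by lia.
    by move=> j1_ltp; apply/ltnW/pos_switch_lt.
  exists w; split=> [||i i_lt i_j]; first exact: walk_from_leq wj.
    by have := pos_switch_leq j; rewrite (@max_fromS j) // /max_gain; lia.
  have [eq_ij|lt_ji] : i = j \/ j < i by lia.
    by case: (i_j eq_ij); lia.
  apply: recw => [|eq_i]; first by lia.
  by split; [apply: pos_switch_lt|apply: pos_switch_leqN1]; lia.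
have pos_t : pos j (r + j%:R)%R = (pos j r).+1.
  rewrite posD pos_label // addn1 ifT ?subn0 //.
  by have := pos_lt j (switch j); lia.
have t0 : (r + j%:R)%R != 0%R.
  by apply: contra_eq_neq pos_t => ->; rewrite pos0.
have [||w [wj eqw recw]] := IHr (r + j%:R)%R; try lia.
exists ((r, j) :: w); split=> [||i i_lt i_j].
- rewrite walk_from_cons /in_graph /source /target /label /= eqxx t0 leqnn wj.
  by lia.
- by rewrite /=; lia.
have [lt_ji|eq_ij] : j < i \/ i = j by lia.
  have [|e [e_w eq_e inc_e]] := recw i i_lt; first by lia.
  by exists e; split; rewrite // inE e_w orbT.
(* If neither end of this edge is [-1], then [-1] lies strictly beyond its target, and so does
   [switch j]: the inner induction applies. *)
case: (boolP (incident (p := p) (r, j) (- 1)%R)) => [inc_r|].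
  by exists (r, j); split; rewrite // inE eqxx.
rewrite /incident /source /target /label /= negb_or => /andP[r_N1 t_N1].
have [_ le_N1] := i_j eq_ij; have leN1 := posN1_leq_switch j_lt.
have neq_r : pos j r != pos j (- 1)%R by rewrite (inj_eq (pos_inj j_lt)).
have : pos j (r + j%:R)%R != pos j (- 1)%R by rewrite (inj_eq (pos_inj j_lt)).
rewrite pos_t => neq_t.
have [|e [e_w eq_e inc_e]] := recw i i_lt; first by lia.
by exists e; split; rewrite // inE e_w orbT.
Qed.

End PrimeModulus.

Local Open Scope ring_scope.

Theorem theorem4p6 (p : nat) (p_prime : prime p) (p_odd : odd p) :
  exists w : seq (edge p),
    unique (longest (@walk p)) w /\
    unique (longest (fun u : seq (edge p) =>
                       walk u /\ recurrent ((p.-1)%:R : 'Z_p) u)) w.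
Proof.
have p_gt1 := prime_gt1 p_prime.
have lt1 : (0 < 1 < p)%N by [].
have posN1_1 : pos 1 (- 1 : 'Z_p) = p.-1.
  by rewrite posN1 // -[X in pos 1 X]/(1%:R) pos_label // subn1.
have [||w [w_walk size_w rec_w]] :=
  exists_maximal_recurrent_walk p_prime p_odd (j := 1) (r := 0).
- by lia.
- by rewrite pos0.
have [walk_w bound] : walk w /\
    forall w' : seq (edge p), walk w' -> (size w' <= size w)%N.
  split=> [|w' /walkP w'_walk]; first exact/walkP.
  by have := size_walk_from p_prime p_odd _ w'_walk; lia.
have recurrent_w : recurrent ((p.-1)%:R : 'Z_p) w.
  have -> : (p.-1)%:R = - 1 :> 'Z_p.
    by apply/eqP; rewrite -addr_eq0 natr1 prednK ?pchar_Zp //; lia.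
  move=> i i_lt; apply: rec_w => [|_]; first by lia.
  have := posN1_leq_switch p_prime p_odd lt1.
  by rewrite posN1_1 pos0; lia.
have longest_w (w' : seq (edge p)) :
    walk w' -> (size w <= size w')%N -> w = w'.
  move=> walk_w' le_size; have le_size' := bound _ walk_w'.
  move/walkP: walk_w' => w'_walk.
  by apply: (maximal_walk_inj p_prime p_odd _ w_walk w'_walk); lia.
exists w; split; split.
- by [].
- by move=> w' [walk_w' /(_ _ walk_w)]; apply: longest_w.
- by split=> // w' [/bound].
(* Since [w] is itself recurrent, a longest recurrent walk is at least as long as [w]. *)
- by move=> w' [[walk_w' _] /(_ _ (conj walk_w recurrent_w))]; apply: longest_w.
Qed.
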